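(* Let $X$ be a based digital image with basepoint $x_0$ and let $\mathrm{cl}(X)$ be its clique complex, with basepoint $x_0$. For a based loop $\alpha\colon I_M\to X$ let $\mathrm{e}(\alpha)=\{\alpha(0),\alpha(1),\ldots,\alpha(M)\}$ be the corresponding edge loop in $\mathrm{cl}(X)$. Then the map $$\phi\colon \pi_1(X;x_0)\to \mathrm{E}(\mathrm{cl}(X);x_0),\qquad \phi([\alpha])=[\mathrm{e}(\alpha)],$$ from the digital fundamental group of $X$ to the edge group of $\mathrm{cl}(X)$ is an isomorphism of groups (in particular it is well defined).
   Context: Digital images and the digital fundamental group. A digital image is a finite subset $X\subseteq\mathbb{Z}^n$ (for some $n$) with the adjacency relation $x\sim_X y$ iff $|x_i-y_i|\le 1$ for all $i=1,\ldots,n$ (reflexive and symmetric). A based digital image also has a chosen basepoint $x_0\in X$. A function $f\colon X\to Y$ of digital images is continuous if $x\sim_X x'$ implies $f(x)\sim_Y f(x')$. For $N\ge 0$, $I_N=\{0,1,\ldots,N\}\subseteq\mathbb{Z}$. Products carry the adjacency $(x,y)\sim(x',y')$ iff $x\sim x'$ and $y\sim y'$. A based loop of length $N$ in $X$ is a continuous $\alpha\colon I_N\to X$ with $\alpha(0)=\alpha(N)=x_0$. Based loops $\alpha,\beta\colon I_M\to X$ of the same length are based homotopic as based loops, $\alpha\approx\beta$, if for some $R\ge1$ there is a continuous $H\colon I_M\times I_R\to X$ with $H(s,0)=\alpha(s)$, $H(s,R)=\beta(s)$ and $H(0,t)=H(M,t)=x_0$ for all $s,t$. For $k\ge1$ let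 $\rho_k\colon I_{kN+k-1}\to I_N$, $\rho_k(i)=\lfloor i/k\rfloor$. Based loops $\alpha\colon I_M\to X$, $\beta\colon I_N\to X$ are subdivision-based homotopic if for some $k,l\ge1$ with $k(M+1)=l(N+1)$ we have $\alpha\circ\rho_k\approx\beta\circ\rho_l$ as based loops. This is an equivalence relation on the based loops of all lengths; $\pi_1(X;x_0)$ is the set of classes $[\alpha]$. It is a group under $[\alpha]\cdot[\beta]=[\alpha\cdot\beta]$, where for $\alpha\colon I_M\to X$, $\beta\colon I_N\to X$ the loop $\alpha\cdot\beta\colon I_{M+N+1}\to X$ equals $\alpha(t)$ for $0\le t\le M$ and $\beta(t-(M+1))$ for $M+1\le t\le M+N+1$; the identity is the class of constant loops, and inverses are given by reversing loops. Clique complex. $\mathrm{cl}(X)$ is the (abstract) simplicial complex with vertex set $X$ whose simplices are the nonempty subsets of pairwise adjacent points of $X$. Edge group. Let $K$ be a simplicial complex with basepoint vertex $v_0$. An edge path is a finite sequence $\{v_0,v_1,\ldots,v_n\}$ of vertices such that, for each $i$, $v_i=v_{i+1}$ or $\{v_i,v_{i+1}\}$ is an edge of $K$; it is an edge loop based at $v_0$ if it starts and ends at $v_0$. Elementary edge-homotopies (relative the endpoints) are: (a) delete one of two equal consecutive vertices $v_i=v_{i+1}$, or conversely insert a repeat of a vertex next to it; (b) if the set $\{v_{i-1},v_i,v_{i+1}\}$ is a simplex of $K$ ($1\le i\le n-1$; repeated vertices allowed, so the simplex may have dimension less than 2), delete $v_i$, or conversely insert between $v_i$ and $v_{i+1}$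 a vertex $v$ for which $\{v_i,v,v_{i+1}\}$ is a simplex of $K$. Two edge paths with the same endpoints are edge-homotopic if they are related by a finite sequence of elementary edge-homotopies. $\mathrm{E}(K;v_0)$ is the set of edge-homotopy classes of edge loops based at $v_0$, a group under the product induced by concatenation $\{v_0,\ldots,v_n\}\cdot\{w_0,\ldots,w_m\}=\{v_0,\ldots,v_n,w_1,\ldots,w_m\}$ (with $v_n=w_0$). *)

(* Defs.v *)
From HB Require Import structures.
From Stdlib Require Import Relation_Operators.
From mathcomp Require Import all_boot all_order all_algebra finmap.
From mathcomp Require Import boolp zify.

Set Implicit Arguments.
Unset Strict Implicit.
Unset Printing Implicit Defensive.

Import Order.TTheory GRing.Theory Num.Theory.

Local Open Scope quotient_scope.

(* {eq_quot _} needs boolean relations on choice types; boolp provides them   *)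
(* for the undecidable homotopy relations below.                              *)

Notation lattice n := {ffun 'I_n -> int}.

Definition lattice_adj n (x y : lattice n) : bool :=
  [forall i, (`|x i - y i| <= 1)%R].

Definition adj n (X : {fset lattice n}) (x y : X) : bool :=
  lattice_adj (val x) (val y).

(* 'I_N.+1 is the digital interval {0, ..., N}.                               *)
Definition interval_adj N (i j : 'I_N.+1) : bool :=
  (`|i%:Z - j%:Z| <= 1)%R.

Definition prod_adj (A B : Type) (eA : rel A) (eB : rel B) : rel (A * B) :=
  fun p q => eA p.1 q.1 && eB p.2 q.2.

Definition digital_continuous (A B : Type) (eA : rel A) (eB : rel B)
    (f : A -> B) : Prop :=
  forall a a', eA a a' -> eB (f a) (f a').

Lemma adj_refl n (X : {fset lattice n}) : reflexive (@adj n X).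
Proof. by move=> x; apply/forallP => i; rewrite subrr normr0. Qed.

Lemma adj_sym n (X : {fset lattice n}) : symmetric (@adj n X).
Proof. by move=> x y; apply: eq_forallb => i; rewrite distrC. Qed.

Lemma interval_adjE N (i j : 'I_N.+1) :
  interval_adj i j = (i <= j.+1) && (j <= i.+1).
Proof. rewrite /interval_adj; lia. Qed.

Section FundamentalGroup.
Variables (n : nat) (X : {fset lattice n}) (x0 : X).

Record based_loop (N : nat) := BasedLoop {
  loop_fun :> 'I_N.+1 -> X;
  loop_continuous : digital_continuous (@interval_adj N) (@adj n X) loop_fun;
  loop_start : loop_fun ord0 = x0;
  loop_end : loop_fun ord_max = x0
}.

Definition based_homotopic M (a b : based_loop M) : Prop :=
  exists2 R, 0 < R & exists H : 'I_M.+1 * 'I_R.+1 -> X,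
    [/\ digital_continuous
          (prod_adj (@interval_adj M) (@interval_adj R)) (@adj n X) H,
        forall s, H (s, ord0) = a s,
        forall s, H (s, ord_max) = b s
      & forall t, H (ord0, t) = x0 /\ H (ord_max, t) = x0].

(* The projection rho_k; i %/ k <= N always holds, so inord does not truncate *)
Definition rho k N (i : 'I_(k * N + k - 1).+1) : 'I_N.+1 := inord (i %/ k).

Lemma val_rho k N (i : 'I_(k * N + k - 1).+1) : rho i = i %/ k :> nat.
Proof.
rewrite /rho inordK //; case: k i => [|k] i; first by rewrite divn0.
by rewrite ltn_divLR //; have := ltn_ord i; lia.
Qed.

Lemma divn_lip k s s' : s <= s'.+1 -> s %/ k <= (s' %/ k).+1.
Proof.
case: k => [|k] h; first by rewrite !divn0.
apply: (@leq_trans ((s' + k.+1) %/ k.+1)); first by apply: leq_div2r; lia.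
by rewrite divnDr // divnn addn1.
Qed.

Lemma rho_continuous k N :
  digital_continuous (@interval_adj (k * N + k - 1)) (@interval_adj N) (@rho k N).
Proof.
move=> i j; rewrite !interval_adjE !val_rho => /andP[h1 h2].
by rewrite !divn_lip.
Qed.

Lemma rho_start k N : @rho k N ord0 = ord0.
Proof. by apply: ord_inj; rewrite val_rho div0n. Qed.

Lemma subdivide_end k N (a : based_loop N) : a (@rho k N ord_max) = x0.
Proof.
case: k => [|k].
  rewrite (_ : rho _ = ord0) ?loop_start //.
  by apply: ord_inj; rewrite val_rho divn0.
rewrite (_ : rho _ = ord_max) ?loop_end //; apply: ord_inj; rewrite val_rho /=.
rewrite (_ : k.+1 * N + k.+1 - 1 = N * k.+1 + k); last by lia.
by rewrite divnMDl // divn_small ?addn0.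
Qed.

Definition subdivide k N (a : based_loop N) : based_loop (k * N + k - 1) :=
  @BasedLoop _ (fun i => a (rho i))
    (fun i j ij => loop_continuous a (rho_continuous ij))
    (etrans (congr1 a (rho_start k N)) (loop_start a))
    (subdivide_end k a).

Definition cast_loop M N (e : M = N) (a : based_loop M) : based_loop N :=
  ecast i (based_loop i) e a.

(* The cast transports along the equality of lengths that k(M+1) = l(N+1)     *)
(* entails.                                                                   *)
Definition subdivision_homotopic M N (a : based_loop M) (b : based_loop N) :=
  exists k l : nat, [/\ 0 < k, 0 < l, k * (M + 1) = l * (N + 1)
    & exists e : k * M + k - 1 = l * N + l - 1,
        based_homotopic (cast_loop e (subdivide k a)) (subdivide l b)].

Definition constant_loop (N : nat) : based_loop N :=
  @BasedLoop _ (fun=> x0) (fun _ _ _ => adj_refl x0) erefl erefl.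

Definition concat_fun M N (a : 'I_M.+1 -> X) (b : 'I_N.+1 -> X)
    (i : 'I_(M + N + 1).+1) : X :=
  if i <= M then a (inord i) else b (inord (i - (M + 1))).

Lemma concat_continuous M N (a : based_loop M) (b : based_loop N) :
  digital_continuous (@interval_adj (M + N + 1)) (@adj n X) (concat_fun a b).
Proof.
move=> i j; rewrite interval_adjE /concat_fun => /andP[h1 h2].
have [hi hj] := (ltn_ord i, ltn_ord j).
have [iM|iM] := leqP i M; have [jM|jM] := leqP j M.
- apply: loop_continuous; rewrite interval_adjE !inordK; lia.
- have -> : inord i = ord_max :> 'I_M.+1.
    by apply: val_inj; rewrite /= inordK; lia.
  have -> : inord (j - (M + 1)) = ord0 :> 'I_N.+1.
    by apply: val_inj; rewrite /= inordK; lia.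
  by rewrite loop_start loop_end adj_refl.
- have -> : inord j = ord_max :> 'I_M.+1.
    by apply: val_inj; rewrite /= inordK; lia.
  have -> : inord (i - (M + 1)) = ord0 :> 'I_N.+1.
    by apply: val_inj; rewrite /= inordK; lia.
  by rewrite loop_start loop_end adj_refl.
- apply: loop_continuous; rewrite interval_adjE !inordK; lia.
Qed.

Lemma concat_start M N (a : based_loop M) (b : based_loop N) :
  concat_fun a b ord0 = x0.
Proof.
rewrite /concat_fun /= -[RHS](loop_start a); congr (a _).
by apply: val_inj; rewrite /= inordK.
Qed.

Lemma concat_end M N (a : based_loop M) (b : based_loop N) :
  concat_fun a b ord_max = x0.
Proof.
rewrite /concat_fun /= leqNgt (_ : M < M + N + 1) /=; last by lia.
rewrite -[RHS](loop_end b); congr (b _).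
by apply: val_inj; rewrite /= inordK; lia.
Qed.

Definition concat M N (a : based_loop M) (b : based_loop N) :
    based_loop (M + N + 1) :=
  BasedLoop (concat_continuous a b) (concat_start a b) (concat_end a b).

Lemma reverse_continuous N (a : based_loop N) :
  digital_continuous (@interval_adj N) (@adj n X) (fun i => a (rev_ord i)).
Proof.
move=> i j; rewrite interval_adjE => ij; apply: loop_continuous.
rewrite interval_adjE /=; have [] := (ltn_ord i, ltn_ord j); lia.
Qed.

Lemma reverse_start N (a : based_loop N) : a (rev_ord ord0) = x0.
Proof. by rewrite -(loop_end a); congr (a _); apply: val_inj => /=; lia. Qed.

Lemma reverse_end N (a : based_loop N) : a (rev_ord ord_max) = x0.
Proof. by rewrite -(loop_start a); congr (a _); apply: val_inj => /=; lia. Qed.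

Definition reverse N (a : based_loop N) : based_loop N :=
  BasedLoop (reverse_continuous a) (reverse_start a) (reverse_end a).

(* Only used in proofs: loops and homotopies as functions on nat,             *)
(* considered up to a bound, and reparametrisations of bounded intervals.     *)
Definition nat_near s s' := (s <= s'.+1) && (s' <= s.+1).

Definition nat_loop M (f : nat -> X) : Prop :=
  [/\ forall s s', s <= M -> s' <= M -> nat_near s s' -> adj (f s) (f s'),
      f 0 = x0 & f M = x0].

Definition nat_homotopic M (f g : nat -> X) : Prop :=
  exists2 R, 0 < R & exists H : nat -> nat -> X,
    [/\ forall s t s' t', s <= M -> t <= R -> s' <= M -> t' <= R ->
          nat_near s s' -> nat_near t t' -> adj (H s t) (H s' t'),
        forall s, s <= M -> H s 0 = f s,
        forall s, s <= M -> H s R = g s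
      & forall t, t <= R -> H 0 t = x0 /\ H M t = x0].

Definition reparam L M (u : nat -> nat) : Prop :=
  [/\ forall s, s <= L -> u s <= M,
      forall s s', s <= L -> s' <= L -> nat_near s s' -> nat_near (u s) (u s'),
      u 0 = 0 & u L = M].

Definition nat_equiv M (f : nat -> X) N (g : nat -> X) : Prop :=
  exists L u v, [/\ reparam L M u, reparam L N v
                  & nat_homotopic L (f \o u) (g \o v)].

Lemma nat_near_sym s s' : nat_near s s' = nat_near s' s.
Proof. by rewrite /nat_near andbC. Qed.

Lemma nat_homotopic_eq M f g :
  nat_loop M f -> (forall s, s <= M -> f s = g s) -> nat_homotopic M f g.
Proof.
move=> [fc f0 fM] fg; exists 1 => //; exists (fun s _ => f s); split=> //.
by move=> s t s' t' hs _ hs' _ ss' _; apply: fc.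
Qed.

Lemma nat_homotopic_sym M f g : nat_homotopic M f g -> nat_homotopic M g f.
Proof.
move=> [R R0 [H [Hc H0 HR He]]]; exists R => //; exists (fun s t => H s (R - t)).
split=> [s t s' t' hs ht hs' ht' ss' tt'|s hs|s hs|t ht].
- by apply: Hc => //; rewrite ?leq_subr //; move: tt'; rewrite /nat_near; lia.
- by rewrite subn0 HR.
- by rewrite subnn H0.
- by apply: He; rewrite leq_subr.
Qed.

Lemma nat_homotopic_trans M f g h :
  nat_homotopic M f g -> nat_homotopic M g h -> nat_homotopic M f h.
Proof.
move=> [R R0 [H [Hc H0 HR He]]] [R' R'0 [H' [Hc' H0' HR' He']]].
exists (R + R'); first by rewrite addn_gt0 R0.
exists (fun s t => if t <= R then H s t else H' s (t - R)).
split=> [s t s' t' hs ht hs' ht' ss' tt'|s hs|s hs|t ht].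
- have [tR|tR] := leqP t R; have [tR'|tR'] := leqP t' R.
  + exact: Hc.
  + have -> : t = R by move: tt'; rewrite /nat_near; lia.
    rewrite HR // -H0' //; apply: Hc' => //; first lia.
    by move: tt'; rewrite /nat_near; lia.
  + have -> : t' = R by move: tt'; rewrite /nat_near; lia.
    rewrite HR // -H0' //; apply: Hc' => //; first lia.
    by move: tt'; rewrite /nat_near; lia.
  + apply: Hc' => //; try lia.
    by move: tt'; rewrite /nat_near; lia.
- by rewrite H0.
- rewrite leqNgt -{1}[R]addn0 ltn_add2l R'0 /= addKn; exact: HR'.
- by case: leqP => tR; [apply: He | apply: He'; lia].
Qed.

Lemma nat_homotopic_comp L M u f g : reparam L M u ->
  nat_homotopic M f g -> nat_homotopic L (f \o u) (g \o u).
Proof.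
move=> [uM uc u0 uL] [R R0 [H [Hc H0 HR He]]]; exists R => //.
exists (fun s t => H (u s) t); split=> [s t s' t' hs ht hs' ht' ss' tt'|s hs|s hs|t ht].
- by apply: Hc => //; [apply: uM|apply: uM|apply: uc].
- by rewrite H0 //; apply: uM.
- by rewrite HR //; apply: uM.
- by rewrite u0 uL; apply: He.
Qed.

Lemma nat_loop_comp L M u f : reparam L M u -> nat_loop M f -> nat_loop L (f \o u).
Proof.
move=> [uM uc u0 uL] [fc f0 fM]; split=> [s s' hs hs' ss'||] /=.
- by apply: fc; [apply: uM|apply: uM|apply: uc].
- by rewrite u0.
- by rewrite uL.
Qed.

Lemma reparam_max L M f u v : nat_loop M f -> reparam L M u -> reparam L M v ->
  nat_homotopic L (f \o u) (fun s => f (maxn (u s) (v s))).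
Proof.
move=> [fc f0 fM] [uM uc u0 uL] [vM vc v0 vL]; exists M.+1 => //.
exists (fun s t => f (maxn (u s) (minn (v s) t))).
split=> [s t s' t' hs ht hs' ht' ss' tt'|s hs|s hs|t ht].
- apply: fc.
  + by have := uM s hs; have := vM s hs; lia.
  + by have := uM s' hs'; have := vM s' hs'; lia.
  + move: (uc s s' hs hs' ss') (vc s s' hs hs' ss') tt'; rewrite /nat_near; lia.
- by rewrite minn0 maxn0.
- by congr f; have := vM s hs; lia.
- by rewrite u0 v0 uL vL min0n max0n f0; split=> //; rewrite -[RHS]fM; congr f; lia.
Qed.

Lemma reparam_homotopic L M f u v : nat_loop M f ->
  reparam L M u -> reparam L M v -> nat_homotopic L (f \o u) (f \o v).
Proof.
move=> fl ul vl; have h1 := reparam_max fl ul vl; have h2 := reparam_max fl vl ul.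
apply: nat_homotopic_trans h1 _; apply: nat_homotopic_sym.
rewrite (_ : (fun s => f (maxn (u s) (v s))) = fun s => f (maxn (v s) (u s))) //.
by apply/funext => s; rewrite maxnC.
Qed.

Lemma reparam_id M : reparam M M id. Proof. by split. Qed.

Lemma reparam_comp L M N u v :
  reparam L M u -> reparam M N v -> reparam L N (v \o u).
Proof.
move=> [uM uc u0 uL] [vM vc v0 vL]; split=> [s hs|s s' hs hs' ss'||] /=.
- by apply/vM/uM.
- by apply: vc; [apply: uM|apply: uM|apply: uc].
- by rewrite u0.
- by rewrite uL.
Qed.

Lemma reparam_div k M T : 0 < k -> T.+1 = k * M.+1 -> reparam T M (divn^~ k).
Proof.
move=> k0 e; split=> [s hs|s s' hs hs' /andP[h1 h2]||].
- by rewrite -ltnS ltn_divLR // mulnC -e.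
- by rewrite /nat_near !divn_lip.
- exact: div0n.
- case: k k0 e => // k _ e.
  by rewrite (_ : T = M * k.+1 + k) ?divnMDl ?divn_small ?addn0 //; lia.
Qed.

Lemma nat_equiv_refl M f g : nat_loop M f ->
  (forall s, s <= M -> f s = g s) -> nat_equiv M f M g.
Proof.
move=> fl fg; exists M, id, id; split; [exact: reparam_id|exact: reparam_id|].
exact: nat_homotopic_eq.
Qed.

Lemma nat_equiv_sym M f N g : nat_equiv M f N g -> nat_equiv N g M f.
Proof.
by move=> [L [u [v [ul vl h]]]]; exists L, v, u; split=> //; apply: nat_homotopic_sym.
Qed.

Lemma nat_equiv_trans M f N g P h : nat_loop N g ->
  nat_equiv M f N g -> nat_equiv N g P h -> nat_equiv M f P h.
Proof.
move=> gl [L [u [v [ul vl uv]]]] [L' [u' [v' [ul' vl' uv']]]].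
pose T := (L.+1 * L'.+1).-1.
have TE : T.+1 = L.+1 * L'.+1 by rewrite prednK.
have d' : reparam T L (divn^~ L'.+1) by apply: reparam_div; lia.
have d : reparam T L' (divn^~ L.+1) by apply: reparam_div; lia.
exists T, (u \o divn^~ L'.+1), (v' \o divn^~ L.+1).
split; [exact: reparam_comp d' ul|exact: reparam_comp d vl'|].
apply: nat_homotopic_trans (nat_homotopic_comp d' uv) _.
apply: nat_homotopic_trans _ (nat_homotopic_comp d uv').
exact: reparam_homotopic gl (reparam_comp d' vl) (reparam_comp d ul').
Qed.

Lemma nat_equiv_reparam L M f u : nat_loop M f -> reparam L M u ->
  nat_equiv L (f \o u) M f.
Proof.
move=> fl ul; exists L, id, u; split=> //.
exact: nat_homotopic_eq (nat_loop_comp ul fl) _.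
Qed.

Definition nat_fun M (a : based_loop M) (s : nat) : X := a (inord s).

Lemma nat_fun_loop M (a : based_loop M) : nat_loop M (nat_fun a).
Proof.
split=> [s s' hs hs' ss'||].
- by apply: loop_continuous; rewrite interval_adjE !inordK.
- by rewrite -(loop_start a); congr (a _); apply: val_inj; rewrite /= inordK.
- by rewrite -(loop_end a); congr (a _); apply: val_inj; rewrite /= inordK.
Qed.

Lemma based_homotopicP M (a b : based_loop M) :
  based_homotopic a b <-> nat_homotopic M (nat_fun a) (nat_fun b).
Proof.
split=> -[R R0 [H [Hc H0 HR He]]]; exists R => //.
  exists (fun s t => H (inord s, inord t)).
  have i0 : inord 0 = ord0 :> 'I_R.+1 by apply: val_inj; rewrite /= inordK.
  have iR : inord R = ord_max :> 'I_R.+1 by apply: val_inj; rewrite /= inordK.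
  split=> [s t s' t' hs ht hs' ht' ss' tt'|s hs|s hs|t ht].
  - by apply: Hc; rewrite /prod_adj /= !interval_adjE !inordK //; apply/andP.
  - by rewrite i0 H0.
  - by rewrite iR HR.
  - have [h1 h2] := He (inord t); split; [rewrite -[RHS]h1|rewrite -[RHS]h2]; congr (H (_, _));
    by apply: val_inj; rewrite /= inordK.
exists (fun p : 'I_M.+1 * 'I_R.+1 => H p.1 p.2); split=> [[s t] [s' t']|s|s|t] /=.
- rewrite /prod_adj /= !interval_adjE => /andP[ss' tt'].
  by apply: Hc => //; rewrite -ltnS.
- by rewrite H0 ?/nat_fun ?inord_val // -ltnS.
- by rewrite HR ?/nat_fun ?inord_val // -ltnS.
- by apply: He; rewrite -ltnS.
Qed.

Lemma nat_fun_cast M N (e : M = N) (a : based_loop M) :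
  nat_fun (cast_loop e a) = nat_fun a.
Proof. by case: N / e. Qed.

Lemma nat_fun_subdivide k N (a : based_loop N) s : s <= k * N + k - 1 ->
  nat_fun (subdivide k a) s = nat_fun a (s %/ k).
Proof.
move=> hs; rewrite /nat_fun /=; congr (a _); apply: ord_inj.
rewrite val_rho inordK //= inordK //.
case: k hs => [|k] hs; first by rewrite divn0.
by rewrite ltn_divLR //; lia.
Qed.

Lemma subdivision_homotopicP M N (a : based_loop M) (b : based_loop N) :
  subdivision_homotopic a b <-> nat_equiv M (nat_fun a) N (nat_fun b).
Proof.
have [al bl] := (nat_fun_loop a, nat_fun_loop b).
have div_eq k P (c : based_loop P) : 0 < k ->
    nat_homotopic (k * P + k - 1) (nat_fun (subdivide k c)) (nat_fun c \o divn^~ k).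
  move=> k0; apply: nat_homotopic_eq; first exact: nat_fun_loop.
  by move=> s hs; rewrite nat_fun_subdivide.
split.
  move=> [k [l [k0 l0 kl [e]]]] /based_homotopicP; rewrite nat_fun_cast => h.
  exists (l * N + l - 1), (divn^~ k), (divn^~ l); split.
  - apply: reparam_div => //; lia.
  - apply: reparam_div => //; lia.
  - apply: nat_homotopic_trans _ (div_eq l _ b l0).
    apply: nat_homotopic_trans _ h; apply: nat_homotopic_sym.
    by rewrite -e; apply: div_eq.
move=> [L [u [v [ul vl h]]]].
pose k := L.+1 * N.+1; pose l := L.+1 * M.+1; pose m := M.+1 * N.+1.
have k0 : 0 < k by rewrite muln_gt0.
have l0 : 0 < l by rewrite muln_gt0.
have e1 : (l * N + l - 1).+1 = m * L.+1 by rewrite /l /m; nia.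
have e2 : (l * N + l - 1).+1 = k * M.+1 by rewrite /l /k; nia.
have e3 : (l * N + l - 1).+1 = l * N.+1 by rewrite /l; nia.
have e : k * M + k - 1 = l * N + l - 1 by apply: succn_inj; rewrite e2; nia.
exists k, l; split=> //; first by rewrite !addn1 -e2 -e3.
exists e; apply/based_homotopicP; rewrite nat_fun_cast.
have dm : reparam (l * N + l - 1) L (divn^~ m) by apply: reparam_div.
have dk : reparam (l * N + l - 1) M (divn^~ k) by apply: reparam_div.
have dl : reparam (l * N + l - 1) N (divn^~ l) by apply: reparam_div.
apply: nat_homotopic_trans _ (nat_homotopic_sym (div_eq _ _ b l0)).
apply: (@nat_homotopic_trans _ _ (nat_fun a \o divn^~ k)).
  by rewrite -e; apply: div_eq.
apply: nat_homotopic_trans (reparam_homotopic al dk (reparam_comp dm ul)) _.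
apply: nat_homotopic_trans (nat_homotopic_comp dm h) _.
exact: reparam_homotopic bl (reparam_comp dm vl) dl.
Qed.

Definition any_loop : Type := {N : nat & based_loop N}.
HB.instance Definition _ := gen_eqMixin any_loop.
HB.instance Definition _ := gen_choiceMixin any_loop.

Definition any_loop_equiv : rel any_loop :=
  fun a b => `[< subdivision_homotopic (tagged a) (tagged b) >].

Lemma any_loop_equiv_is_equiv : equiv_class_of any_loop_equiv.
Proof.
split=> [[M a]|[M a] [N b]|[N b] [M a] [P c]]; rewrite /any_loop_equiv /=.
- apply/asboolP/subdivision_homotopicP.
  exact: nat_equiv_refl (nat_fun_loop a) _.
- by apply/asboolP/asboolP; move=> /subdivision_homotopicP/nat_equiv_sym h;
    apply/subdivision_homotopicP.
- move=> /asboolP/subdivision_homotopicP h /asboolP/subdivision_homotopicP h'.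
  apply/asboolP/subdivision_homotopicP.
  exact: nat_equiv_trans (nat_fun_loop b) h h'.
Qed.

Canonical any_loop_equiv_equiv := EquivRelPack any_loop_equiv_is_equiv.

Definition fundamental_group := {eq_quot any_loop_equiv}.
HB.instance Definition _ := Choice.on fundamental_group.

Definition loop_class N (a : based_loop N) : fundamental_group :=
  \pi_{eq_quot any_loop_equiv} (Tagged based_loop a).

Lemma loop_classP M N (a : based_loop M) (b : based_loop N) :
  loop_class a = loop_class b <-> subdivision_homotopic a b.
Proof.
split=> [/eqmodP/asboolP //|h].
by apply/eqmodP/asboolP.
Qed.

Lemma loop_class_repr (c : fundamental_group) :
  loop_class (tagged (repr c)) = c.
Proof. by rewrite /loop_class -[RHS]reprK; congr (\pi _); case: (repr c). Qed.

Lemma loop_class_surj (c : fundamental_group) :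
  exists N, exists a : based_loop N, c = loop_class a.
Proof. by exists (tag (repr c)), (tagged (repr c)); rewrite loop_class_repr. Qed.

Definition fundamental_one : fundamental_group := loop_class (constant_loop 0).

Definition fundamental_mul (c d : fundamental_group) : fundamental_group :=
  loop_class (concat (tagged (repr c)) (tagged (repr d))).

Definition fundamental_inv (c : fundamental_group) : fundamental_group :=
  loop_class (reverse (tagged (repr c))).

Definition nat_cat L (f g : nat -> X) (s : nat) : X :=
  if s <= L then f s else g (s - L.+1).

Lemma nat_fun_concat M N (a : based_loop M) (b : based_loop N) s :
  s <= M + N + 1 ->
  nat_fun (concat a b) s = nat_cat M (nat_fun a) (nat_fun b) s.
Proof.
by move=> hs; rewrite /nat_fun /= /concat_fun inordK // addn1.
Qed.

Lemma nat_cat_homotopic L L' f g f' g' :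
  nat_homotopic L f g -> nat_homotopic L' f' g' ->
  nat_homotopic (L + L' + 1) (nat_cat L f f') (nat_cat L g g').
Proof.
move=> [R R0 [H [Hc H0 HR He]]] [R' R'0 [H' [Hc' H0' HR' He']]].
exists (R + R'); first by rewrite addn_gt0 R0.
exists (fun s t => if s <= L then H s (minn t R) else H' (s - L.+1) (minn t R')).
split=> [s t s' t' hs ht hs' ht' ss' tt'|s hs|s hs|t ht].
- have [sL|sL] := leqP s L; have [sL'|sL'] := leqP s' L.
  + by apply: Hc => //; rewrite ?geq_minr //; move: tt'; rewrite /nat_near; lia.
  + have -> : s = L by move: ss'; rewrite /nat_near; lia.
    have -> : s' - L.+1 = 0 by move: ss'; rewrite /nat_near; lia.
    have [|_ ->] := He (minn t R); first by rewrite geq_minr.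
    have [|-> _] := He' (minn t' R'); first by rewrite geq_minr.
    exact: adj_refl.
  + have -> : s' = L by move: ss'; rewrite /nat_near; lia.
    have -> : s - L.+1 = 0 by move: ss'; rewrite /nat_near; lia.
    have [|_ ->] := He (minn t' R); first by rewrite geq_minr.
    have [|-> _] := He' (minn t R'); first by rewrite geq_minr.
    exact: adj_refl.
  + by apply: Hc'; rewrite ?geq_minr //; try lia;
      move: ss' tt'; rewrite /nat_near; lia.
- by rewrite /nat_cat !min0n; case: leqP => sL; [apply: H0|apply: H0'; lia].
- rewrite /nat_cat (minn_idPr (leq_addr _ _)) (minn_idPr (leq_addl _ _)).
  by case: leqP => sL; [apply: HR|apply: HR'; lia].
- rewrite leq0n (_ : L + L' + 1 <= L = false); last by lia.
  rewrite (_ : L + L' + 1 - L.+1 = L'); last by lia.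
  by split; [case: (He (minn t R))|case: (He' (minn t R'))]; rewrite ?geq_minr.
Qed.

Lemma nat_cat_equiv M f M' f' N g N' g' :
  nat_equiv M f M' f' -> nat_equiv N g N' g' ->
  nat_equiv (M + N + 1) (nat_cat M f g) (M' + N' + 1) (nat_cat M' f' g').
Proof.
have rc L P Q u v P' : reparam L P u -> reparam Q P' v ->
    reparam (L + Q + 1) (P + P' + 1)
      (fun s => if s <= L then u s else P.+1 + v (s - L.+1)).
  move=> [uM uc u0 uL] [vM vc v0 vL]; split=> [s hs|s s' hs hs' ss'||].
  - case: (leqP s L) => sL; first by have := uM s sL; lia.
    have := vM (s - L.+1); lia.
  - have [sL|sL] := leqP s L; have [sL'|sL'] := leqP s' L.
    + exact: uc.
    + have -> : s = L by move: ss'; rewrite /nat_near; lia.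
      have -> : s' - L.+1 = 0 by move: ss'; rewrite /nat_near; lia.
      by rewrite uL v0 /nat_near; lia.
    + have -> : s' = L by move: ss'; rewrite /nat_near; lia.
      have -> : s - L.+1 = 0 by move: ss'; rewrite /nat_near; lia.
      by rewrite uL v0 /nat_near; lia.
    + have : nat_near (v (s - L.+1)) (v (s' - L.+1)).
        by apply: vc; try lia; move: ss'; rewrite /nat_near; lia.
      rewrite /nat_near; lia.
  - by rewrite leq0n u0.
  - rewrite (_ : L + Q + 1 <= L = false); last by lia.
    by rewrite (_ : L + Q + 1 - L.+1 = Q) ?vL; lia.
move=> [L [u [v [ul vl h]]]] [Q [u' [v' [ul' vl' h']]]].
exists (L + Q + 1), (fun s => if s <= L then u s else M.+1 + u' (s - L.+1)),
  (fun s => if s <= L then v s else M'.+1 + v' (s - L.+1)).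
split; [exact: rc|exact: rc|].
have := nat_cat_homotopic h h'.
have aux w w' P (p q : nat -> X) : reparam L P w -> forall s,
    nat_cat L (p \o w) (q \o w') s =
    (nat_cat P p q \o (fun s => if s <= L then w s else P.+1 + w' (s - L.+1))) s.
  move=> [wM _ _ _] s; rewrite /nat_cat /=; case: (leqP s L) => sL; first by rewrite wM.
  by rewrite ifF ?addKn //; lia.
by rewrite (funext (aux _ _ _ _ _ ul)) (funext (aux _ _ _ _ _ vl)).
Qed.

Lemma concat_equiv M M' N N' (a : based_loop M) (a' : based_loop M')
    (b : based_loop N) (b' : based_loop N') :
  subdivision_homotopic a a' -> subdivision_homotopic b b' ->
  subdivision_homotopic (concat a b) (concat a' b').
Proof.
move=> /subdivision_homotopicP h /subdivision_homotopicP h'.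
apply/subdivision_homotopicP.
have E P Q (p : based_loop P) (q : based_loop Q) :
    nat_equiv (P + Q + 1) (nat_fun (concat p q))
              (P + Q + 1) (nat_cat P (nat_fun p) (nat_fun q)).
  apply: nat_equiv_refl (nat_fun_loop _) _ => s hs; exact: nat_fun_concat.
have C P Q (p : based_loop P) (q : based_loop Q) :
    nat_loop (P + Q + 1) (nat_cat P (nat_fun p) (nat_fun q)).
  have [c c0 c1] := nat_fun_loop (concat p q).
  by split=> [s s' hs hs' ss'||]; rewrite -?nat_fun_concat //; apply: c.
apply: nat_equiv_trans (C _ _ _ _) (E _ _ a b) _.
apply: nat_equiv_trans (C _ _ _ _) (nat_cat_equiv h h') _.
exact/nat_equiv_sym/E.
Qed.

Lemma reverse_equiv M N (a : based_loop M) (b : based_loop N) :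
  subdivision_homotopic a b -> subdivision_homotopic (reverse a) (reverse b).
Proof.
move=> /subdivision_homotopicP[L [u [v [ul vl [R R0 [H [Hc H0 HR He]]]]]]].
have rr P w : reparam L P w -> reparam L P (fun s => P - w (L - s)).
  move=> [wM wc w0 wL]; split=> [s hs|s s' hs hs' ss'||]; rewrite ?leq_subr //.
  - have : nat_near (w (L - s)) (w (L - s')).
      by apply: wc; rewrite ?leq_subr //; move: ss'; rewrite /nat_near; lia.
    by rewrite /nat_near; lia.
  - by rewrite subn0 wL subnn.
  - by rewrite subnn w0 subn0.
have re P w (p : based_loop P) s : reparam L P w -> s <= L ->
    nat_fun (reverse p) (P - w (L - s)) = nat_fun p (w (L - s)).
  move=> [wM _ _ _] hs; have h := wM (L - s) (leq_subr _ _).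
  by rewrite /nat_fun /=; congr (p _); apply: val_inj; rewrite /= !inordK; lia.
apply/subdivision_homotopicP; exists L, (fun s => M - u (L - s)), (fun s => N - v (L - s)).
split; [exact: rr|exact: rr|exists R => //].
exists (fun s t => H (L - s) t); split=> [s t s' t' hs ht hs' ht' ss' tt'|s hs|s hs|t ht].
- by apply: Hc; rewrite ?leq_subr //; move: ss'; rewrite /nat_near; lia.
- by rewrite H0 ?leq_subr //; apply/esym/re.
- by rewrite HR ?leq_subr //; apply/esym/re.
- by rewrite subn0 subnn; have [] := He t ht.
Qed.

Lemma loop_class_mul M N (a : based_loop M) (b : based_loop N) :
  fundamental_mul (loop_class a) (loop_class b) = loop_class (concat a b).
Proof.
by apply/loop_classP/concat_equiv; apply/loop_classP; rewrite loop_class_repr.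
Qed.

Lemma loop_class_inv M (a : based_loop M) :
  fundamental_inv (loop_class a) = loop_class (reverse a).
Proof.
by apply/loop_classP/reverse_equiv; apply/loop_classP; rewrite loop_class_repr.
Qed.

Lemma loop_class_reparam L M (a : based_loop M) (b : based_loop L) u :
  reparam L M u ->
  (forall s, s <= L -> nat_fun b s = nat_fun a (u s)) ->
  loop_class b = loop_class a.
Proof.
move=> ul ba; apply/loop_classP/subdivision_homotopicP.
apply: (@nat_equiv_trans _ _ L (nat_fun a \o u)).
- exact: nat_loop_comp ul (nat_fun_loop a).
- exact: nat_equiv_refl (nat_fun_loop b) _.
- exact: nat_equiv_reparam (nat_fun_loop a) ul.
Qed.

Lemma loop_class_constant N : loop_class (constant_loop N) = fundamental_one.
Proof.
apply/loop_classP/subdivision_homotopicP; exists N, id, (fun=> 0).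
split; [exact: reparam_id| by split|].
exact: nat_homotopic_eq (nat_fun_loop (constant_loop N)) _.
Qed.

Lemma fundamental_mulA : associative fundamental_mul.
Proof.
move=> c d e; have [M [a ->]] := loop_class_surj c.
have [N [b ->]] := loop_class_surj d; have [P [f ->]] := loop_class_surj e.
rewrite !loop_class_mul; apply: (@loop_class_reparam _ _ _ _ id).
  by rewrite (_ : M + (N + P + 1) + 1 = M + N + 1 + P + 1); [split|lia].
move=> s hs; rewrite !nat_fun_concat; try lia.
rewrite /= {1 2}/nat_cat; case: (leqP s M) => sM.
  by rewrite ifT; [rewrite nat_fun_concat /nat_cat ?sM //; lia|lia].
rewrite nat_fun_concat; last by lia.
case: (leqP s (M + N + 1)) => sN.
  by rewrite nat_fun_concat // /nat_cat [s <= M]leqNgt sM /= ifT //; lia.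
by rewrite /nat_cat ifF; [congr (nat_fun f _); lia|lia].
Qed.

Lemma fundamental_mul1 : right_id fundamental_one fundamental_mul.
Proof.
move=> c; have [M [a ->]] := loop_class_surj c; rewrite loop_class_mul.
apply: (@loop_class_reparam _ _ _ _ (minn^~ M)).
  by split=> [s hs|s s' hs hs'||]; rewrite /nat_near; lia.
move=> s hs; cbv beta; rewrite nat_fun_concat // /nat_cat; case: leqP => sM //.
by have [_ _ ->] := nat_fun_loop a.
Qed.

Lemma fundamental_1mul : left_id fundamental_one fundamental_mul.
Proof.
move=> c; have [M [a ->]] := loop_class_surj c; rewrite loop_class_mul.
apply: (@loop_class_reparam _ _ _ _ predn).
  by split=> [s hs|s s' hs hs'||]; rewrite /nat_near; lia.
move=> s hs; rewrite nat_fun_concat // /nat_cat; case: leqP => s0.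
  rewrite (_ : s = 0); last lia.
  by have [_ -> _] := nat_fun_loop a.
by rewrite subn1.
Qed.

Lemma fundamental_mulV : right_inverse fundamental_one fundamental_inv fundamental_mul.
Proof.
move=> c; have [M [a ->]] := loop_class_surj c.
rewrite loop_class_inv loop_class_mul -(loop_class_constant (M + M + 1)).
apply/loop_classP/subdivision_homotopicP; exists (M + M + 1), id, id.
split; [exact: reparam_id|exact: reparam_id|apply: nat_homotopic_sym].
have [ac a0 aM] := nat_fun_loop a.
exists M.+1 => //.
exists (fun s t => nat_fun a (minn (minn s (M + M + 1 - s)) t)).
split=> [s t s' t' hs ht hs' ht' ss' tt'|s hs|s hs|t ht].
- by apply: ac; move: ss' tt'; rewrite /nat_near; lia.
- by rewrite minn0 a0.
- rewrite [RHS](nat_fun_concat a (reverse a) hs) /nat_cat.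
  case: (leqP s M) => sM.
    by congr (nat_fun a _); lia.
  rewrite /nat_fun /=; congr (a _); apply: val_inj; rewrite /= !inordK; lia.
- by rewrite !min0n subnn minn0 min0n a0.
Qed.

Lemma fundamental_Vmul : left_inverse fundamental_one fundamental_inv fundamental_mul.
Proof.
move=> c; have e : fundamental_inv (fundamental_inv c) = c.
  rewrite -[LHS]fundamental_1mul -(fundamental_mulV c) -fundamental_mulA.
  by rewrite fundamental_mulV fundamental_mul1.
by rewrite -{2}e fundamental_mulV.
Qed.

HB.instance Definition _ := isGroup.Build fundamental_group
  fundamental_mulA fundamental_1mul fundamental_mul1
  fundamental_Vmul fundamental_mulV.

End FundamentalGroup.

Record simplicial_complex (V : finType) := SimplicialComplex {
  simplices : {set {set V}};
  simplex_neq0 : set0 \notin simplices;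
  simplex1 : forall v, [set v] \in simplices;
  simplex_face : forall s t : {set V},
    s \in simplices -> t \subset s -> t != set0 -> t \in simplices
}.

Section CliqueComplex.
Variables (n : nat) (X : {fset lattice n}).

Definition clique_simplices : {set {set X}} :=
  [set s : {set X} |
    (s != set0) && [forall x in s, forall y in s, adj x y]].

Lemma cliqueP (s : {set X}) :
  reflect (s != set0 /\ {in s &, forall x y, adj x y}) (s \in clique_simplices).
Proof.
rewrite inE; apply: (iffP andP) => -[s0 h]; split=> //.
  by move=> x y xs ys; have /forall_inP/(_ x xs)/forall_inP := h; apply.
by apply/forall_inP => x xs; apply/forall_inP => y ys; apply: h.
Qed.

Lemma clique_neq0 : set0 \notin clique_simplices.
Proof. by rewrite inE eqxx. Qed.

Lemma clique1 v : [set v] \in clique_simplices.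
Proof.
apply/cliqueP; split; first by apply/set0Pn; exists v; rewrite set11.
by move=> x y /set1P-> /set1P->; apply: adj_refl.
Qed.

Lemma clique_face (s t : {set X}) :
  s \in clique_simplices -> t \subset s -> t != set0 -> t \in clique_simplices.
Proof.
move=> /cliqueP[_ h] /subsetP ts t0; apply/cliqueP; split=> // x y /ts xs /ts ys.
exact: h.
Qed.

Definition clique_complex : simplicial_complex X :=
  SimplicialComplex clique_neq0 clique1 clique_face.

End CliqueComplex.

Section EdgeGroup.
Variables (V : finType) (K : simplicial_complex V) (v0 : V).

Definition edge_step (v w : V) : bool := (v == w) || ([set v; w] \in simplices K).

Definition is_edge_path (p : seq V) : bool :=
  if p is v :: q then path edge_step v q else false.

Definition is_edge_loop (p : seq V) : bool :=
  [&& is_edge_path p, head v0 p == v0 & last v0 p == v0].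

Record edge_loop := EdgeLoop {
  edge_seq :> seq V;
  edge_seqP : is_edge_loop edge_seq
}.
HB.instance Definition _ := [isSub for edge_seq].
HB.instance Definition _ := [Choice of edge_loop by <:].

(* Deletions only: insertions are the converse relation. Deleting or          *)
(* inserting v_i in (b) requires neighbours on both sides, so that endpoints  *)
(* are fixed.                                                                 *)
Inductive elementary_deletion : seq V -> seq V -> Prop :=
| delete_repeat p v q :
    elementary_deletion (p ++ v :: v :: q) (p ++ v :: q)
| delete_simplex p u v w q : [set u; v; w] \in simplices K ->
    elementary_deletion (p ++ u :: v :: w :: q) (p ++ u :: w :: q).

Definition edge_homotopic : edge_loop -> edge_loop -> Prop :=
  clos_refl_sym_trans edge_loop (fun p q => elementary_deletion p q).

Definition edge_homotopicb : rel edge_loop := fun p q => `[< edge_homotopic p q >].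

Lemma edge_homotopicb_is_equiv : equiv_class_of edge_homotopicb.
Proof.
split=> [p|p q|q p r].
- exact/asboolP/rst_refl.
- by apply/asboolP/asboolP; apply: rst_sym.
- by move=> /asboolP h /asboolP h'; apply/asboolP/(rst_trans _ _ _ _ _ h h').
Qed.

Canonical edge_homotopicb_equiv := EquivRelPack edge_homotopicb_is_equiv.

Definition edge_group := {eq_quot edge_homotopicb}.
HB.instance Definition _ := Choice.on edge_group.

Definition edge_class (p : edge_loop) : edge_group := \pi_{eq_quot edge_homotopicb} p.

Lemma edge_classP p q : edge_class p = edge_class q <-> edge_homotopic p q.
Proof. by split=> [/eqmodP/asboolP //|h]; apply/eqmodP/asboolP. Qed.

Lemma edge_class_repr (c : edge_group) : edge_class (repr c) = c.
Proof. exact: reprK. Qed.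

(* Edge homotopy of sequences, ignoring whether they are edge loops; on edge  *)
(* loops it is the same relation (seq_homotopicP).                            *)
Definition seq_homotopic : seq V -> seq V -> Prop :=
  clos_refl_sym_trans (seq V) elementary_deletion.

Lemma edge_step_refl : reflexive edge_step.
Proof. by move=> v; rewrite /edge_step eqxx. Qed.

Lemma edge_step_sym : symmetric edge_step.
Proof. by move=> v w; rewrite /edge_step eq_sym setUC. Qed.

Lemma simplex_edge_step (s : {set V}) v w :
  s \in simplices K -> v \in s -> w \in s -> edge_step v w.
Proof.
move=> sK vs ws; apply/orP; right; apply: simplex_face sK _ _.
  by apply/subsetP => x /set2P[] ->.
by apply/set0Pn; exists v; rewrite set21.
Qed.

Lemma is_edge_path_cat p v q :
  is_edge_path (p ++ v :: q) = is_edge_path (rcons p v) && path edge_step v q.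
Proof.
by case: p => [|x p] //=; rewrite cat_path /= rcons_path; rewrite -andbA.
Qed.

Lemma elementary_deletion_loop p q :
  elementary_deletion p q -> is_edge_loop p = is_edge_loop q.
Proof.
case=> {p q} [p v q|p u v w q s]; rewrite /is_edge_loop.
  rewrite !is_edge_path_cat /= edge_step_refl /= !last_cat /=.
  by case: p.
rewrite !is_edge_path_cat /= !last_cat /=.
have [-> -> ->] : [/\ edge_step u v, edge_step v w & edge_step u w].
  by split; apply: simplex_edge_step s _ _; rewrite !inE eqxx ?orbT.
by case: p.
Qed.

Lemma seq_homotopic_loop p q :
  seq_homotopic p q -> is_edge_loop p = is_edge_loop q.
Proof.
elim=> {p q} [p q h|p|p q _ h|p q r _ h _ h'] //; first exact: elementary_deletion_loop.
by rewrite h h'.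
Qed.

Lemma seq_homotopicP (p q : edge_loop) : edge_homotopic p q <-> seq_homotopic p q.
Proof.
split.
  elim=> {p q} [p q h|p|p q _ h|p q r _ h _ h'].
  - exact: rst_step.
  - exact: rst_refl.
  - exact: rst_sym.
  - exact: rst_trans h h'.
case: p q => [p pP] [q qP] /= h.
elim: h pP qP => {p q} [p q h|p|p q _ h|p q r h1 h _ h'] pP qP.
- exact: rst_step.
- by rewrite (bool_irrelevance pP qP); apply: rst_refl.
- by apply: rst_sym; apply: h.
- have rP : is_edge_loop q by rewrite -(seq_homotopic_loop h1).
  exact: rst_trans (h pP rP) (h' rP qP).
Qed.

Lemma seq_homotopic_ctx a b p q :
  seq_homotopic p q -> seq_homotopic (a ++ p ++ b) (a ++ q ++ b).
Proof.
elim=> {p q} [p q h|p|p q _ h|p q r _ h _ h'].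
- apply: rst_step; case: h => {p q} [p v q|p u v w q s].
    by rewrite -!catA /= !catA; apply: delete_repeat.
  by rewrite -!catA /= !catA; apply: delete_simplex.
- exact: rst_refl.
- exact: rst_sym.
- exact: rst_trans h h'.
Qed.

Lemma seq_homotopic_rev p q : seq_homotopic p q -> seq_homotopic (rev p) (rev q).
Proof.
elim=> {p q} [p q h|p|p q _ h|p q r _ h _ h'].
- apply: rst_step; case: h => {p q} [p v q|p u v w q s].
    by rewrite !rev_cat !rev_cons -!cats1 -!catA /=; apply: delete_repeat.
  rewrite !rev_cat !rev_cons -!cats1 -!catA /=; apply: delete_simplex.
  by rewrite (_ : [set w; v; u] = [set u; v; w]) //; apply/setP => x; rewrite !inE; do 3 case: eqP.
- exact: rst_refl.
- exact: rst_sym.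
- exact: rst_trans h h'.
Qed.

Lemma trivial_edge_loopP : is_edge_loop [:: v0].
Proof. by rewrite /is_edge_loop /= eqxx. Qed.

Definition trivial_edge_loop : edge_loop := EdgeLoop trivial_edge_loopP.

Lemma edge_loop_cons (p : edge_loop) : edge_seq p = v0 :: behead p.
Proof. by case: p => -[|v p] //= /and3P[_ /eqP /= ->]. Qed.

Lemma edge_concatP (p q : edge_loop) : is_edge_loop (p ++ behead q).
Proof.
have := edge_loop_cons q; case: p q => [p pP] [q qP] /= qE.
move: pP qP; rewrite /is_edge_loop => /and3P[h /eqP h0 /eqP h1].
rewrite qE /= => /and3P[k _ /eqP k1].
case: p h h0 h1 => //= v p h hv; move: h; rewrite hv => h h1.
by rewrite cat_path h last_cat h1 k k1 !eqxx.
Qed.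

Definition edge_concat (p q : edge_loop) : edge_loop := EdgeLoop (edge_concatP p q).

Lemma edge_reverseP (p : edge_loop) : is_edge_loop (rev p).
Proof.
case: p => [[|v p]] //= /and3P[/= h /eqP h0 /eqP h1].
apply/and3P; split; last by rewrite rev_cons last_rcons h0.
  rewrite lastI rev_rcons /= rev_path.
  by rewrite (eq_path (e' := edge_step)) // => x y; rewrite edge_step_sym.
by rewrite lastI rev_rcons /= h1.
Qed.

Definition edge_reverse (p : edge_loop) : edge_loop := EdgeLoop (edge_reverseP p).

Definition edge_one : edge_group := edge_class trivial_edge_loop.

Definition edge_mul (c d : edge_group) : edge_group :=
  edge_class (edge_concat (repr c) (repr d)).

Definition edge_inv (c : edge_group) : edge_group := edge_class (edge_reverse (repr c)).

(* Compared with edge_concat, the sequence p ++ q only repeats v0 once more.  *)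
Lemma edge_concat_cat (p q : edge_loop) : seq_homotopic (edge_concat p q) (p ++ q).
Proof.
apply/rst_sym/rst_step; rewrite (edge_loop_cons q) /=.
case: p => p /= /and3P[]; case/lastP: p => // p v _ _; rewrite last_rcons => /eqP ->.
by rewrite -cats1 -!catA /=; apply: delete_repeat.
Qed.

Lemma edge_concat_homotopic (p p' q q' : edge_loop) :
  edge_homotopic p p' -> edge_homotopic q q' ->
  edge_homotopic (edge_concat p q) (edge_concat p' q').
Proof.
move=> /seq_homotopicP h /seq_homotopicP h'; apply/seq_homotopicP.
apply: rst_trans (edge_concat_cat p q) _.
apply: rst_trans _ (rst_sym _ _ _ _ (edge_concat_cat p' q')).
apply: (@rst_trans _ _ _ (p' ++ q)).
  exact: (@seq_homotopic_ctx [::] q _ _ h).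
by have := seq_homotopic_ctx p' [::] h'; rewrite !cats0.
Qed.

Lemma edge_class_mul (p q : edge_loop) :
  edge_mul (edge_class p) (edge_class q) = edge_class (edge_concat p q).
Proof.
by apply/edge_classP/edge_concat_homotopic; apply/edge_classP; rewrite edge_class_repr.
Qed.

Lemma edge_class_inv (p : edge_loop) :
  edge_inv (edge_class p) = edge_class (edge_reverse p).
Proof.
apply/edge_classP/seq_homotopicP/seq_homotopic_rev/seq_homotopicP/edge_classP.
exact: edge_class_repr.
Qed.

Lemma edge_mulA : associative edge_mul.
Proof.
move=> c d e; rewrite -[c]edge_class_repr -[d]edge_class_repr -[e]edge_class_repr.
rewrite !edge_class_mul; congr edge_class; apply: val_inj => /=.
by rewrite (edge_loop_cons (repr d)) /= catA.
Qed.

Lemma edge_1mul : left_id edge_one edge_mul.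
Proof.
move=> c; rewrite -[c]edge_class_repr edge_class_mul; congr edge_class.
by apply: val_inj; rewrite /= [RHS]edge_loop_cons.
Qed.

Lemma edge_mul1 : right_id edge_one edge_mul.
Proof.
move=> c; rewrite -[c]edge_class_repr edge_class_mul; congr edge_class.
by apply: val_inj; rewrite /= cats0.
Qed.

Lemma cat_rev_homotopic v p : path edge_step v p ->
  seq_homotopic ((v :: p) ++ rev (v :: p)) [:: v].
Proof.
elim: p v => [|w p IHp] v /=.
  by move=> _; apply: rst_step; apply: (@delete_repeat [::]).
move=> /andP[vw /IHp h]; rewrite rev_cons -cats1 catA.
apply: (@rst_trans _ _ _ [:: v; w; v]).
  exact: (@seq_homotopic_ctx [:: v] [:: v] _ _ h).
apply: (@rst_trans _ _ _ [:: v; v]); apply: rst_step; last first.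
  exact: (@delete_repeat [::]).
case/orP: vw => [/eqP <-|vw]; first exact: (@delete_repeat [::]).
apply: (@delete_simplex [::]).
by rewrite (_ : [set v; w; v] = [set v; w]) //; apply/setP => x; rewrite !inE; do 2 case: eqP.
Qed.

Lemma edge_mulV : right_inverse edge_one edge_inv edge_mul.
Proof.
move=> c; rewrite -[c]edge_class_repr edge_class_inv edge_class_mul.
apply/edge_classP/seq_homotopicP; apply: rst_trans (edge_concat_cat _ _) _.
rewrite /= (edge_loop_cons (repr c)); apply: cat_rev_homotopic.
by case: (repr c) => -[|v p] //= /and3P[/= h /eqP <-].
Qed.

Lemma edge_Vmul : left_inverse edge_one edge_inv edge_mul.
Proof.
move=> c; have e : edge_inv (edge_inv c) = c.
  rewrite -[c]edge_class_repr !edge_class_inv; congr edge_class.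
  by apply: val_inj => /=; rewrite revK.
by rewrite -{2}e edge_mulV.
Qed.

HB.instance Definition _ := isGroup.Build edge_group
  edge_mulA edge_1mul edge_mul1 edge_Vmul edge_mulV.

End EdgeGroup.

Section EdgeLoopOfLoop.
Variables (n : nat) (X : {fset lattice n}) (x0 : X).

Lemma edge_of_loopP M (a : based_loop x0 M) :
  is_edge_loop (clique_complex X) x0 [seq a i | i <- enum 'I_M.+1].
Proof.
have nthE i : i < M.+1 -> nth x0 [seq a i | i <- enum 'I_M.+1] i = a (inord i).
  move=> iM; rewrite (nth_map ord0) ?size_enum_ord //; congr (a _).
  by apply: ord_inj; rewrite nth_enum_ord // inordK.
have sz : size [seq a i | i <- enum 'I_M.+1] = M.+1 by rewrite size_map size_enum_ord.
apply/and3P; split.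
- case E : [seq a i | i <- enum 'I_M.+1] => [|v p]; first by rewrite E in sz.
  apply/(pathP x0) => i ip; rewrite -[nth x0 p i]/(nth x0 (v :: p) i.+1) -E.
  have iM : i.+1 < M.+1 by rewrite -sz E.
  rewrite !nthE //; last exact: ltnW.
  have h : adj (a (inord i)) (a (inord i.+1)).
    by apply: loop_continuous; rewrite interval_adjE !inordK //; lia.
  apply/orP; right; apply/cliqueP; split; first by apply/set0Pn; eexists; apply: set21.
  by move=> x y /set2P[] -> /set2P[] ->; rewrite ?adj_refl // adj_sym.
- rewrite -nth0 nthE // -[X in _ == X](loop_start a); apply/eqP; congr (a _).
  by apply: ord_inj; rewrite inordK.
- rewrite -nth_last sz nthE // -[X in _ == X](loop_end a); apply/eqP; congr (a _).
  by apply: ord_inj; rewrite inordK.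
Qed.

Definition edge_of_loop M (a : based_loop x0 M) : edge_loop (clique_complex X) x0 :=
  EdgeLoop (edge_of_loopP a).

End EdgeLoopOfLoop.

(* Main.v *)
Require Import Defs.
From Stdlib Require Import Relation_Operators.
From mathcomp Require Import all_boot all_order all_algebra finmap.
From mathcomp Require Import zify.

(** Both groups are made of classes of the same objects: listing the values of
    a based loop is a bijection from based loops onto edge loops of the clique
    complex, because two points span a simplex exactly when they are adjacent.
    What has to be seen is that the two equivalence relations correspond.

    From loops to edge loops ([edge_of_loop_homotopic]), two things may happen
    to a loop.  Subdividing it by k only repeats each vertex k times
    ([seq_homotopic_mkseq_div]).  A homotopy H is treated one time step after
    the other: the rows f = H(-,t) and g = H(-,t+1) form a ladder of squares
    f(s), f(s+1), g(s), g(s+1) whose vertices are pairwise adjacent, since H is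
    continuous for the product adjacency, where diagonal neighbours are
    adjacent too.  Every square is thus filled by two 2-simplices of the clique
    complex, and a path moves across the ladder square by square
    ([seq_homotopic_ladder]).

    From edge loops to loops ([loop_of_edge_homotopic]), deleting a repeated
    vertex is undone by a reparametrisation.  Replacing u, v, w by u, w across
    a simplex {u, v, w} amounts, after the repeat u, u, w is inserted, to
    changing the single value v into its neighbour u, and this is a digital
    homotopy with one time step, because u and w are adjacent as well.

    Concatenated loops list the two edge loops one after the other, which
    differs from the product of edge loops by one repeat of the basepoint. *)

Section Comparison.
Context {n : nat} {X : {fset lattice n}} {x0 : X}.

Local Notation homotopic := (seq_homotopic (clique_complex X)).

Lemma clique3 {u v w : X} : adj u v -> adj v w -> adj u w ->
  [set u; v; w] \in simplices (clique_complex X).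
Proof.
move=> uv vw uw; apply/cliqueP; split.
  by apply/set0Pn; exists u; rewrite !inE eqxx.
move=> x y; rewrite !inE -!orbA.
by (do 2 case/or3P=> /eqP->); rewrite ?adj_refl // adj_sym.
Qed.

Lemma simplex_adj {s : {set X}} {u v : X} :
  s \in simplices (clique_complex X) -> u \in s -> v \in s -> adj u v.
Proof. by move=> /cliqueP[_ h]; apply: h. Qed.

Lemma edge_step_adj (u v : X) : edge_step (clique_complex X) u v -> adj u v.
Proof.
case/orP=> [/eqP->|h]; first exact: adj_refl.
by apply: (simplex_adj h); rewrite !inE eqxx ?orbT.
Qed.

(** * From loops to edge loops *)

Lemma mkseqD {T : Type} (f : nat -> T) l m :
  mkseq f (l + m) = mkseq f l ++ mkseq (fun i => f (l + i)) m.
Proof.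
by rewrite /mkseq iotaD map_cat add0n -{2}[l]addn0 iotaDl -map_comp.
Qed.

Lemma edge_of_loopE {M} (a : based_loop x0 M) :
  edge_seq (edge_of_loop a) = mkseq (nat_fun a) M.+1.
Proof.
rewrite /= /mkseq -val_enum_ord -map_comp; apply: eq_map => i /=.
by rewrite /nat_fun inord_val.
Qed.

Lemma seq_homotopic_nseq k (v : X) : homotopic (nseq k.+1 v) [:: v].
Proof.
elim: k => [|k IHk]; first exact: rst_refl.
by apply: rst_trans IHk; apply: rst_step; apply: (@delete_repeat _ _ [::]).
Qed.

Lemma seq_homotopic_mkseq_div k (f : nat -> X) m : 0 < k ->
  homotopic (mkseq (fun s => f (s %/ k)) (k * m)) (mkseq f m).
Proof.
case: k => // k _; elim: m => [|m IHm]; first by rewrite muln0; apply: rst_refl.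
rewrite mulnSr mkseqD (mkseqS f) -cats1.
have -> : mkseq (fun i => f ((k.+1 * m + i) %/ k.+1)) k.+1 = nseq k.+1 (f m).
  apply: (@eq_from_nth _ x0) => [|i]; rewrite size_mkseq ?size_nseq // => ik.
  by rewrite nth_mkseq // nth_nseq ik mulnC divnMDl // divn_small ?addn0.
apply: (rst_trans _ _ _ (mkseq f m ++ nseq k.+1 (f m))).
  exact: (@seq_homotopic_ctx _ _ [::]).
by have := seq_homotopic_ctx (mkseq f m) [::] (seq_homotopic_nseq k (f m));
  rewrite !cats0.
Qed.

(** Each rung turns g(i), f(i), f(i+1) into g(i), g(i+1), f(i+1): the triangle
    with vertices g(i), f(i), f(i+1) allows to drop f(i), then the triangle
    with vertices g(i), g(i+1), f(i+1) allows to insert g(i+1). *)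
Lemma seq_homotopic_ladder (f g : nat -> X) i m :
  (forall s, i <= s <= i + m -> adj (g s) (f s)) ->
  (forall s, i <= s < i + m ->
     [/\ adj (f s) (f s.+1), adj (g s) (g s.+1) & adj (g s) (f s.+1)]) ->
  homotopic (g i :: map f (iota i m.+1)) (map g (iota i m.+1) ++ [:: f (i + m)]).
Proof.
elim: m i => [|m IHm] i gf sq; first by rewrite /= addn0; apply: rst_refl.
have [|ff gg gf1] := sq i; first by lia.
apply: (rst_trans _ _ _ (g i :: map f (iota i.+1 m.+1))).
  apply: rst_step; apply: (@delete_simplex _ _ [::]); apply: clique3 => //.
  by apply: gf; lia.
apply: (rst_trans _ _ _ (g i :: g i.+1 :: map f (iota i.+1 m.+1))).
  apply: rst_sym; apply: rst_step; apply: (@delete_simplex _ _ [::]).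
  by apply: clique3 => //; apply: gf; lia.
rewrite -[i + m.+1]addSnnS.
have h : homotopic (g i.+1 :: map f (iota i.+1 m.+1))
    (map g (iota i.+1 m.+1) ++ [:: f (i.+1 + m)]).
  by apply: IHm => s hs; [apply: gf|apply: sq]; lia.
by have := seq_homotopic_ctx [:: g i] [::] h; rewrite !cats0.
Qed.

Lemma nat_homotopic_seq {M} {f g : nat -> X} :
  nat_homotopic x0 M f g -> homotopic (mkseq f M.+1) (mkseq g M.+1).
Proof.
case=> R _ [H [Hc H0 HR He]].
have row h t : (forall s, s <= M -> H s t = h s) ->
    mkseq (H^~ t) M.+1 = mkseq h M.+1.
  by move=> e; apply/eq_in_map => s; rewrite mem_iota => /andP[_ hs]; apply: e.
rewrite -(row f 0) // -(row g R) //.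
suff step t : t <= R -> homotopic (mkseq (H^~ 0) M.+1) (mkseq (H^~ t) M.+1).
  exact: step.
elim: t => [|t IHt] tR; first exact: rst_refl.
apply: rst_trans (IHt (ltnW tR)) _.
have [[st0 stM] [s0 sM]] := (He t (ltnW tR), He t.+1 tR).
(* Both rows start and end at x0, so the extra vertices at the two ends of the
   ladder are repeats. *)
apply: (rst_trans _ _ _ (H 0 t.+1 :: mkseq (H^~ t) M.+1)).
  apply: rst_sym; apply: rst_step; rewrite /mkseq /= st0 s0.
  exact: (@delete_repeat _ _ [::]).
apply: (rst_trans _ _ _ (mkseq (H^~ t.+1) M.+1 ++ [:: H M t])).
  apply: seq_homotopic_ladder => s hs; [|split];
    by apply: Hc => //; rewrite /nat_near; lia.
apply: rst_step; rewrite mkseqS -cats1 -catA /= stM sM.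
exact: delete_repeat.
Qed.

Lemma seq_homotopic_subdivide k {M} (a : based_loop x0 M) : 0 < k ->
  homotopic (mkseq (nat_fun (subdivide k a)) (k * M + k - 1).+1)
    (mkseq (nat_fun a) M.+1).
Proof.
move=> k0.
have -> : mkseq (nat_fun (subdivide k a)) (k * M + k - 1).+1 =
    mkseq (fun s => nat_fun a (s %/ k)) (k * M.+1).
  rewrite (_ : (k * M + k - 1).+1 = k * M.+1); last by lia.
  apply/eq_in_map => s; rewrite mem_iota => /andP[_ hs].
  by apply: nat_fun_subdivide; lia.
exact: seq_homotopic_mkseq_div.
Qed.

Lemma edge_of_loop_homotopic {M N} (a : based_loop x0 M) (b : based_loop x0 N) :
  subdivision_homotopic a b ->
  edge_homotopic (edge_of_loop a) (edge_of_loop b).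
Proof.
move=> [k [l [k0 l0 _ [e /based_homotopicP]]]]; rewrite nat_fun_cast => h.
apply/seq_homotopicP; rewrite !edge_of_loopE.
apply: rst_trans (seq_homotopic_subdivide l b l0).
apply: rst_trans (nat_homotopic_seq h); rewrite -e.
exact/rst_sym/seq_homotopic_subdivide.
Qed.

Lemma edge_of_loop_concat {M N} (a : based_loop x0 M) (b : based_loop x0 N) :
  edge_homotopic (edge_of_loop (concat a b))
    (edge_concat (edge_of_loop a) (edge_of_loop b)).
Proof.
apply/seq_homotopicP; apply: rst_trans (rst_sym _ _ _ _ (edge_concat_cat _ _)).
have -> : edge_seq (edge_of_loop (concat a b)) =
    edge_seq (edge_of_loop a) ++ edge_seq (edge_of_loop b); last exact: rst_refl.
rewrite !edge_of_loopE (_ : (M + N + 1).+1 = M.+1 + N.+1); last by lia.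
rewrite mkseqD; congr (_ ++ _); apply/eq_in_map => s; rewrite mem_iota => hs.
  by rewrite nat_fun_concat /nat_cat ?ifT //; lia.
by rewrite nat_fun_concat /nat_cat ?ifF ?addKn //; lia.
Qed.

(** * From edge loops to loops *)

Local Notation edge_loop := (edge_loop (clique_complex X) x0).

Lemma edge_loop_size (p : edge_loop) : size p = (size p).-1.+1.
Proof. by rewrite edge_loop_cons. Qed.

Lemma edge_loop_nat_loop (p : edge_loop) : nat_loop x0 (size p).-1 (nth x0 p).
Proof.
case: p => [[|v p] // /[dup] pP] /and3P[/= vp /eqP v0 /eqP p0].
have next s : s < size p -> adj (nth x0 (v :: p) s) (nth x0 p s).
  by move=> sp; apply: edge_step_adj; move/(pathP x0): vp; apply.
split=> [s s' hs hs'||] //=; last first.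
  by rewrite -[size p]/(size (v :: p)).-1 nth_last.
rewrite /= in hs hs'; rewrite /nat_near => /andP[ss' s's].
have [lt|lt|->] := ltngtP s s'; last exact: adj_refl.
  have e : s' = s.+1 by lia.
  by rewrite e; apply: next; rewrite -e.
have e : s = s'.+1 by lia.
by rewrite e adj_sym; apply: next; rewrite -e.
Qed.

Lemma edge_loop_continuous (p : edge_loop) :
  digital_continuous (@interval_adj (size p).-1) (@adj n X)
    (fun i => nth x0 p i).
Proof.
have [h _ _] := edge_loop_nat_loop p.
move=> i j; rewrite interval_adjE; apply: h; rewrite -ltnS; exact: ltn_ord.
Qed.

Definition loop_of_edge (p : edge_loop) : based_loop x0 (size p).-1 :=
  BasedLoop (edge_loop_continuous p)
    (let: And3 _ h _ := edge_loop_nat_loop p in h)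
    (let: And3 _ _ h := edge_loop_nat_loop p in h).

Lemma nat_fun_loop_of_edge (p : edge_loop) s : s <= (size p).-1 ->
  nat_fun (loop_of_edge p) s = nth x0 p s.
Proof. by move=> sp; rewrite /nat_fun /= inordK. Qed.

Lemma edge_of_loopK (p : edge_loop) : edge_of_loop (loop_of_edge p) = p.
Proof.
apply: val_inj; rewrite [LHS]edge_of_loopE -edge_loop_size.
apply: (@eq_from_nth _ x0) => [|s]; rewrite size_mkseq // => sp.
by rewrite nth_mkseq // nat_fun_loop_of_edge // -ltnS -edge_loop_size.
Qed.

Lemma loop_of_edgeK {M} (a : based_loop x0 M) :
  loop_class (loop_of_edge (edge_of_loop a)) = loop_class a.
Proof.
have sz : size (edge_of_loop a) = M.+1 by rewrite edge_of_loopE size_mkseq.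
apply: (@loop_class_reparam _ _ _ _ _ _ _ id).
  by rewrite sz; apply: reparam_id.
move=> s hs; rewrite nat_fun_loop_of_edge // edge_of_loopE nth_mkseq //.
by rewrite -sz edge_loop_size.
Qed.

Lemma nth_repeat {T : Type} (d : T) p v q s :
  nth d (p ++ v :: v :: q) s =
  nth d (p ++ v :: q) (if s <= size p then s else s.-1).
Proof.
case: leqP => sp; rewrite !nth_cat.
  case: ltnP => // ps; have -> : s = size p by lia.
  by rewrite subnn.
have [-> ->] : (s < size p) = false /\ (s.-1 < size p) = false by lia.
by have -> : s - size p = (s.-1 - size p).+1 by lia.
Qed.

Lemma reparam_skip {m L : nat} : m <= L ->
  reparam L.+1 L (fun s => if s <= m then s else s.-1).
Proof.
by move=> mL; split=> [s hs|s s' hs hs'||] //; rewrite /nat_near;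
  (do ?case: ifP=> ?); lia.
Qed.

Lemma nat_equiv_delete_repeat {P Q : edge_loop} {p v q} :
  edge_seq P = p ++ v :: v :: q -> edge_seq Q = p ++ v :: q ->
  nat_equiv x0 (size P).-1 (nth x0 P) (size Q).-1 (nth x0 Q).
Proof.
move=> PE QE.
have sz : (size P).-1 = (size Q).-1.+1 by rewrite PE QE !size_cat /=; lia.
have szQ : size p <= (size Q).-1 by rewrite QE size_cat /=; lia.
have ur := reparam_skip szQ; rewrite -sz in ur.
rewrite PE (boolp.funext (nth_repeat x0 p v q)) -PE -QE.
exact: nat_equiv_reparam (edge_loop_nat_loop Q) ur.
Qed.

(** The product adjacency on an interval times {0, 1} only asks for adjacency
    within each of the two rows, which is the continuity of the two loops, and
    across them, at positions that differ by at most one. *)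
Lemma nat_homotopic_adj {M} {f g : nat -> X} :
  nat_loop x0 M f -> nat_loop x0 M g ->
  (forall s s', s <= M -> s' <= M -> nat_near s s' -> adj (f s) (g s')) ->
  nat_homotopic x0 M f g.
Proof.
move=> [fc f0 fM] [gc g0 gM] fg; exists 1 => //.
exists (fun s t => if t == 0 then f s else g s).
split=> // [s t s' t' hs _ hs' _ ss' _|t _]; last by case: eqP.
case: eqP => _; case: eqP => _; [exact: fc|exact: fg| |exact: gc].
by rewrite adj_sym; apply: fg => //; rewrite nat_near_sym.
Qed.

Lemma nth_cat_neq {T : Type} (d : T) p u v v' q s : s != (size p).+1 ->
  nth d (p ++ u :: v :: q) s = nth d (p ++ u :: v' :: q) s.
Proof.
move=> sp; rewrite !nth_cat; case: ltnP => // ps.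
by case E: (s - size p) => [|[|i]] //; lia.
Qed.

(** Shortening the loop is left to the removal of a repeat, so that the
    simplex only has to justify a homotopy between loops of equal length. *)
Lemma nat_equiv_delete_simplex {P Q : edge_loop} {p u v w q} :
  edge_seq P = p ++ u :: v :: w :: q -> edge_seq Q = p ++ u :: w :: q ->
  [set u; v; w] \in simplices (clique_complex X) ->
  nat_equiv x0 (size P).-1 (nth x0 P) (size Q).-1 (nth x0 Q).
Proof.
move=> PE QE uvw.
(* Q' is P with its value v, at index (size p).+1, replaced by u. *)
have Q'P : is_edge_loop (clique_complex X) x0 (p ++ u :: u :: w :: q).
  rewrite (elementary_deletion_loop _ (delete_repeat _ p u (w :: q))) -QE.
  exact: edge_seqP.
pose Q' : edge_loop := EdgeLoop Q'P.
have Pl := edge_loop_nat_loop P; have Q'l := edge_loop_nat_loop Q'.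
apply: nat_equiv_trans (Q'l) _ (nat_equiv_delete_repeat (P := Q') erefl QE).
have sz : size Q' = size P by rewrite PE /= !size_cat.
rewrite sz in Q'l *.
exists (size P).-1, id, id; split; [exact: reparam_id|exact: reparam_id|].
apply: (@nat_homotopic_adj _ (nth x0 P) (nth x0 Q')) => //.
have eqPQ s : s != (size p).+1 -> nth x0 P s = nth x0 Q' s.
  by rewrite PE; apply: nth_cat_neq.
have [Pc _ _] := Pl; have [Q'c _ _] := Q'l; move=> s s' hs hs' ss'.
have [|s1] := eqVneq s (size p).+1; last by rewrite eqPQ //; apply: Q'c.
have [s'1 s1|s'1 _] := eqVneq s' (size p).+1; last by rewrite -eqPQ //; apply: Pc.
rewrite s1 s'1 PE /= !nth_cat ltnNge leqnSn /= subSnn /=.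
by apply: (simplex_adj uvw); rewrite !inE eqxx ?orbT.
Qed.

Lemma nat_equiv_edge_homotopic {p q : edge_loop} : edge_homotopic p q ->
  nat_equiv x0 (size p).-1 (nth x0 p) (size q).-1 (nth x0 q).
Proof.
elim=> {p q} [p q|p|p q _ h|p q r _ h _ h'].
- move Ep: (edge_seq p) => p'; move Eq: (edge_seq q) => q' pq.
  rewrite -Ep -Eq; case: pq Ep Eq => [a v b|a u v w b uvw] Ep Eq.
    exact: nat_equiv_delete_repeat Ep Eq.
  exact: nat_equiv_delete_simplex Ep Eq uvw.
- exact: nat_equiv_refl (edge_loop_nat_loop p) _.
- exact: nat_equiv_sym.
- exact: nat_equiv_trans (edge_loop_nat_loop q) h h'.
Qed.

Lemma loop_of_edge_homotopic {p q : edge_loop} : edge_homotopic p q ->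
  loop_class (loop_of_edge p) = loop_class (loop_of_edge q).
Proof.
move=> pq; apply/loop_classP/subdivision_homotopicP.
have E (r : edge_loop) : nat_equiv x0 (size r).-1 (nat_fun (loop_of_edge r))
                        (size r).-1 (nth x0 r).
  by apply: nat_equiv_refl (nat_fun_loop _) _ => s; apply: nat_fun_loop_of_edge.
apply: nat_equiv_trans (edge_loop_nat_loop p) (E p) _.
apply: nat_equiv_trans (edge_loop_nat_loop q) _ (nat_equiv_sym (E q)).
exact: nat_equiv_edge_homotopic.
Qed.

End Comparison.

(** * The isomorphism *)

Theorem theorem4p6 (n : nat) (X : {fset lattice n}) (x0 : X) :
  exists phi : fundamental_group x0 -> edge_group (clique_complex X) x0,
    [/\ forall (M : nat) (alpha : based_loop x0 M),
          phi (loop_class alpha) = edge_class (edge_of_loop alpha),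
        {morph phi : c d / (c * d)%g}
      & bijective phi].
Proof.
pose phi (c : fundamental_group x0) : edge_group (clique_complex X) x0 :=
  edge_class (edge_of_loop (tagged (repr c))).
have phiE M (a : based_loop x0 M) :
    phi (loop_class a) = edge_class (edge_of_loop a).
  apply/edge_classP/edge_of_loop_homotopic/loop_classP.
  exact: loop_class_repr.
exists phi; split=> // [c d|].
  have [M [a ->]] := loop_class_surj c; have [N [b ->]] := loop_class_surj d.
  rewrite [(loop_class a * _)%g]loop_class_mul !phiE [RHS]edge_class_mul.
  exact/edge_classP/edge_of_loop_concat.
exists (fun d => loop_class (loop_of_edge (repr d))) => [c|d].
  have [M [a ->]] := loop_class_surj c; rewrite phiE -[RHS]loop_of_edgeK.
  apply/loop_of_edge_homotopic/edge_classP; exact: edge_class_repr.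
by rewrite phiE edge_of_loopK edge_class_repr.
Qed.
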